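(* Let $(\varphi_x)_{x\in I}$ be a normalized dictionary for $\mathcal{H}$ (i.e. $\|\varphi_x\|=1$ for all $x\in I$), which is the union of $r$ subdictionaries $\Phi_1,\dots,\Phi_r$, with synthesis operator $D$, and let $A:\mathcal{H}\to\mathbb{K}^m$ be linear and continuous. Let $v_0\in\mathcal{H}$ be given by $$v_0 = D(c^0_{x_0}\delta_{x_0}+\mu^c)= c_{x_0}^0\varphi_{x_0}+D\mu^c$$ for some $x_0\in I$, a scalar $c^0_{x_0}\in\mathbb{K}$ and a measure $\mu^c\in\mathcal{M}(I)$ such that $\|v_0\|_{\mathcal{A}}=\|c^0_{x_0}\delta_{x_0}+\mu^c\|_{TV}=1$. Let $j_0\in\{1,\dots,r\}$ with $\varphi_{x_0}\in\Phi_{j_0}$, and let $\sigma\ge 0$, $t\in(0,1]$. Suppose that there exists $\nu\in\operatorname{ran}A^*$ with $$\operatorname{Re}\int_I\langle\varphi_x,\nu\rangle\, d(c^0_{x_0}\delta_{x_0}+\mu^c)(x)\ge 1,$$ $$\|\nu\|_{\mathcal{A}_j}^*<1\quad\text{for all } j\ne j_0,$$ $$|\langle\nu,\varphi_{x_0}\rangle|\le\sigma,$$ $$\|\Pi_{\langle\varphi_{x_0}\rangle^\perp}\nu\|_{\mathcal{A}_{j_0}}^*\le 1-t.$$ Then: if $\mu_*$ is a solution (minimizer) of $$\min_{\mu\in\mathcal{M}(I)}\|\mu\|_{TV}\ \text{ subject to }\ AD\mu=b,\qquad b=Av_0,$$ there exists an $x\in\operatorname{supp}\mu_*$ with $\varphi_x\in\Phi_{j_0}$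 such that $$|\langle\varphi_x,\varphi_{x_0}\rangle|\ge\frac{t}{\sigma}$$ (with $t/0:=+\infty$).
   Context: $\mathbb{K}\in\{\mathbb{R},\mathbb{C}\}$; $\mathcal{H}$ is a Hilbert space over $\mathbb{K}$ with inner product linear in the first argument; $I$ is a locally compact separable metric space. $\mathcal{C}_0(I)$ is the Banach space (sup norm) of continuous functions $f:I\to\mathbb{K}$ vanishing at infinity, and $\mathcal{M}(I)$ its dual, the space of $\mathbb{K}$-valued Radon measures of finite total variation, with total variation norm $\|\cdot\|_{TV}$. A collection $(\varphi_x)_{x\in I}\subseteq\mathcal{H}$ is a dictionary if the test map $v\mapsto(x\mapsto\langle v,\varphi_x\rangle)$ is a well-defined bounded map $\mathcal{H}\to\mathcal{C}_0(I)$. Its synthesis operator $D:\mathcal{M}(I)\to\mathcal{H}$, $D\mu=\int_I\varphi_x\,d\mu(x)$, is defined weakly by $\langle D\mu,v\rangle=\int_I\langle\varphi_x,v\rangle\,d\mu(x)$ for all $v\in\mathcal{H}$. The atomic norm is $\|v\|_{\mathcal{A}}=\inf\{\|\mu\|_{TV}:\mu\in\mathcal{M}(I),\,D\mu=v\}$ ($=\infty$ if $v\notin\operatorname{ran}D$). The dictionary $\Phi=(\varphi_x)_{x\in I}$ is assumed to consist of $r\geq 1$ subcollections (subdictionaries) $\Phi_1,\dots,\Phi_r$, i.e. $\Phi=\Phi_1\cup\dots\cup\Phi_r$ ($r=1$ is allowed), and $\|v\|_{\mathcal{A}_j}^*=\sup_{\varphi\in\Phi_j}|\langle v,\varphi\rangle|$.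 $A^*$ is the adjoint of $A$, and $\Pi_{\langle\varphi_{x_0}\rangle^\perp}$ is the orthogonal projection onto the orthogonal complement of the span of $\varphi_{x_0}$. *)

(* Defs.v *)
From HB Require Import structures.
From mathcomp Require Import all_boot all_order all_algebra.
From mathcomp Require Import complex.
From mathcomp Require Import all_classical all_reals all_analysis.

Set Implicit Arguments.
Unset Strict Implicit.
Unset Printing Implicit Defensive.

Import Order.TTheory GRing.Theory Num.Theory.
Import numFieldNormedType.Exports.

Local Open Scope classical_set_scope.
Local Open Scope ring_scope.

Variant scalars := RealScalars | ComplexScalars.

Definition scalar_field (R : realType) (k : scalars) : numFieldType :=
  match k with
  | RealScalars => R
  | ComplexScalars => R[i]
  end.

Definition reK (R : realType) (k : scalars) : scalar_field R k -> R :=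
  match k with
  | RealScalars => fun x => x
  | ComplexScalars => fun z => complex.Re z
  end.

Definition imK (R : realType) (k : scalars) : scalar_field R k -> R :=
  match k with
  | RealScalars => fun=> 0
  | ComplexScalars => fun z => complex.Im z
  end.

(* [mkK a b] is [a + i b]; for real scalars [b] is discarded. *)
Definition mkK (R : realType) (k : scalars) : R -> R -> scalar_field R k :=
  match k with
  | RealScalars => fun a _ => a
  | ComplexScalars => fun a b => Complex a b
  end.

Definition conjK (R : realType) (k : scalars) :
    scalar_field R k -> scalar_field R k :=
  match k with
  | RealScalars => fun x => x
  | ComplexScalars => fun z => conjc z
  end.

(* MathComp norms over [K] take values in [K]; [rnorm] is the same norm seen as
   an element of [R]. *)
Definition rnorm (R : realType) (k : scalars)
  (V : normedZmodType (scalar_field R k)) (v : V) : R := reK `|v|.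

(* Measurable types are pointed, so a base point is carried along: this only
   says that the space is nonempty. *)
#[short(type="pmetricType")]
HB.structure Definition PointedMetric (K : numDomainType) :=
  {M of Metric K M & Pointed M}.

Definition borel (R : realType) (I : pmetricType R) : measurableType _ :=
  g_sigma_algebraType (@open I).

Definition separable_space (T : topologicalType) : Prop :=
  exists2 S : set T, countable S & dense S.

Section variation.
Context d (T : measurableType d) (R : realType) (k : scalars).
Local Notation K := (scalar_field R k).

Definition variation_measure (mu : set T -> K) (E : set T) : \bar R :=
  ereal_sup [set (\sum_(0 <= i <oo) (rnorm (mu (F i)))%:E)%E | F in
    [set F : (set T)^nat | [/\ forall i, measurable (F i),
                               trivIset setT F & \bigcup_i F i = E]]].

End variation.


Section scalar_lemmas.
Variables (R : realType) (k : scalars).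
Local Notation K := (scalar_field R k).
Implicit Types x y : K.

Lemma reKD x y : reK (x + y) = reK x + reK y.
Proof. by case: k x y => //= -[? ?] [? ?]. Qed.

Lemma imKD x y : imK (x + y) = imK x + imK y.
Proof. by case: k x y => [x y|[? ?] [? ?]] //=; rewrite addr0. Qed.

Lemma reKN x : reK (- x) = - reK x.
Proof. by case: k x => //= -[? ?]. Qed.

Lemma imKN x : imK (- x) = - imK x.
Proof. by case: k x => [x|[? ?]] //=; rewrite oppr0. Qed.

Lemma reK0 : reK (0 : K) = 0. Proof. by case: k. Qed.

Lemma reK1 : reK (1 : K) = 1. Proof. by case: k. Qed.

Lemma imK0 : imK (0 : K) = 0. Proof. by case: k. Qed.

Lemma reK_mkK (a b : R) : reK (mkK k a b) = a.
Proof. by case: k. Qed.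

Lemma reK_le x y : x <= y -> reK x <= reK y.
Proof. by case: k x y => //= -[? ?] [? ?] /=; rewrite lecE => /andP[]. Qed.

Lemma reK_lt x y : x < y -> reK x < reK y.
Proof. by case: k x y => //= -[? ?] [? ?] /=; rewrite ltcE => /andP[]. Qed.

Lemma rnorm_ge0 (V : normedZmodType K) (v : V) : 0 <= rnorm v.
Proof. by rewrite -reK0; exact: reK_le. Qed.

Lemma ler_rnormD (V : normedZmodType K) (v w : V) :
  rnorm (v + w) <= rnorm v + rnorm w.
Proof. by rewrite -reKD; apply: reK_le; exact: ler_normD. Qed.

Lemma rnorm0 (V : normedZmodType K) : rnorm (0 : V) = 0.
Proof. by rewrite /rnorm normr0 reK0. Qed.

Lemma rnormM x y : rnorm (x * y) = rnorm x * rnorm y.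
Proof.
rewrite /rnorm normrM.
by case: k x y => //= x y; rewrite mul0r subr0.
Qed.

Lemma normr_reK_le x : `|reK x| <= rnorm x.
Proof.
case: k x => //= -[a b]; rewrite /rnorm /=.
by rewrite -sqrtr_sqr ler_wsqrtr// lerDl sqr_ge0.
Qed.

Lemma normr_imK_le x : `|imK x| <= rnorm x.
Proof.
case: k x => [x|[a b]]; first by rewrite normr0; exact: normr_ge0.
rewrite /rnorm /=.
by rewrite -sqrtr_sqr ler_wsqrtr// lerDr sqr_ge0.
Qed.

Lemma cvg_rnorm (u : nat -> K) (l : K) : u @ \oo --> l ->
  forall eps : R, 0 < eps -> \forall n \near \oo, rnorm (l - u n) < eps.
Proof.
move=> /cvgrPdist_lt ul eps eps0.
have eps0' : 0 < mkK k eps 0.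
  by case: k => //=; rewrite ltcE /= eqxx eps0.
by apply: filterS (ul _ eps0') => n /reK_lt; rewrite reK_mkK.
Qed.

Lemma cvg_reK (u : nat -> K) (l : K) : u @ \oo --> l ->
  (fun n => reK (u n)) @ \oo --> reK l.
Proof.
move=> /cvg_rnorm ul; apply/cvgrPdist_lt => eps eps0.
apply: filterS (ul _ eps0) => n; apply: le_lt_trans.
by rewrite -reKN -reKD; exact: normr_reK_le.
Qed.

Lemma cvg_imK (u : nat -> K) (l : K) : u @ \oo --> l ->
  (fun n => imK (u n)) @ \oo --> imK l.
Proof.
move=> /cvg_rnorm ul; apply/cvgrPdist_lt => eps eps0.
apply: filterS (ul _ eps0) => n; apply: le_lt_trans.
by rewrite -imKN -imKD; exact: normr_imK_le.
Qed.

End scalar_lemmas.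

Section variation_lemmas.
Context d (T : measurableType d) (R : realType) (k : scalars).
Local Notation K := (scalar_field R k).
Implicit Types (mu nu : set T -> K) (E : set T).
Local Open Scope ereal_scope.

Lemma variation_mono mu E1 E2 : measurable E1 -> measurable E2 ->
  E1 `<=` E2 -> variation_measure mu E1 <= variation_measure mu E2.
Proof.
move=> mE1 mE2 E12; apply: ge_ereal_sup => _ [F [mF tF FE] <-].
pose G i := if i is n.+1 then F n else E2 `\` E1.
apply: (@le_trans _ _ (\sum_(0 <= i <oo) (rnorm (mu (G i)))%:E)).
  have G0 i : 0 <= (rnorm (mu (G i)))%:E by rewrite lee_fin rnorm_ge0.
  rewrite [leRHS]nneseries_recl//.
  rewrite -[leLHS]add0e; apply: leeD; first by rewrite lee_fin rnorm_ge0.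
  rewrite -[leRHS]nneseries_addn//.
  by apply: lee_nneseries => [i _ _|i _]; rewrite ?addn1 ?lee_fin ?rnorm_ge0.
apply: ereal_sup_ubound; exists G => //; split.
- by move=> [|n] //=; exact: measurableD.
- apply/trivIsetP => -[|i] [|j] //= _ _ ij.
  + by apply/seteqP; split=> // x [[_ nx] Fx]; apply: nx; rewrite -FE; exists j.
  + by apply/seteqP; split=> // x [Fx [_ nx]]; apply: nx; rewrite -FE; exists i.
  + by move/trivIsetP : tF; exact.
- apply/seteqP; split=> [x [[|i] _ /=]|x E2x].
  + by case.
  + by move=> Fx; apply: E12; rewrite -FE; exists i.
  + have [E1x|nE1x] := pselect (E1 x); last by exists 0%N.
    by move: E1x; rewrite -FE => -[i _ Fx]; exists i.+1.
Qed.

Lemma variationD mu nu E :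
  variation_measure (fun B => mu B + nu B)%R E <= variation_measure mu E + variation_measure nu E.
Proof.
apply: ge_ereal_sup => _ [F FE <-].
apply: (@le_trans _ _ (\sum_(0 <= i <oo) (rnorm (mu (F i)))%:E +
                       \sum_(0 <= i <oo) (rnorm (nu (F i)))%:E)).
  rewrite -nneseriesD; try by move=> i _ _; rewrite lee_fin rnorm_ge0.
  apply: lee_nneseries => [i _ _|i _]; first by rewrite lee_fin rnorm_ge0.
  by rewrite -EFinD lee_fin ler_rnormD.
by apply: leeD; apply: ereal_sup_ubound; exists F.
Qed.

Lemma variationZ (c : K) mu E :
  variation_measure (fun B => c * mu B)%R E <= (rnorm c)%:E * variation_measure mu E.
Proof.
apply: ge_ereal_sup => _ [F FE <-].
rewrite (eq_eseriesr (g := fun i => (rnorm c)%:E * (rnorm (mu (F i)))%:E)); last first.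
  by move=> i _; rewrite rnormM EFinM.
rewrite nneseriesZl; last by move=> i _; rewrite lee_fin rnorm_ge0.
apply: lee_wpmul2l; first by rewrite lee_fin rnorm_ge0.
by apply: ereal_sup_ubound; exists F.
Qed.

End variation_lemmas.

Record radon_measure (R : realType) (k : scalars) (I : pmetricType R) :=
  RadonMeasure {
  mval :> set (borel I) -> scalar_field R k ;
  mval0 : mval set0 = 0 ;
  mval_sigma : forall F : (set (borel I))^nat,
    (forall i, measurable (F i)) -> trivIset setT F ->
    (fun n => \sum_(0 <= i < n) mval (F i)) @ \oo --> mval (\bigcup_i F i) ;
  mval_tv : (variation_measure mval setT < +oo)%E ;
  mval_regular : forall (B : set (borel I)) (eps : R),
    measurable B -> 0 < eps ->
    exists C : set I, [/\ @compact I C, C `<=` B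
                        & (variation_measure mval (B `\` C) < eps%:E)%E]
}.

Section radon_measure_operations.
Variables (R : realType) (k : scalars) (I : pmetricType R).
Local Notation K := (scalar_field R k).
Local Notation M := (radon_measure k I).

Lemma compact_borel (C : set I) : compact C -> measurable (C : set (borel I)).
Proof.
move=> /(compact_closed (@metric_hausdorff R I)) cC.
rewrite -(setCK C); apply: measurableC; apply: sub_sigma_algebra.
by rewrite openC.
Qed.

Section dirac.
Variable x0 : I.
Let f (B : set (borel I)) : K := \1_B x0.

Let f0 : f set0 = 0. Proof. by rewrite /f indicE in_set0. Qed.

Let f_sigma (F : (set (borel I))^nat) :
  (forall i, measurable (F i)) -> trivIset setT F ->
  (fun n => \sum_(0 <= i < n) f (F i)) @ \oo --> f (\bigcup_i F i).
Proof.
move=> _ tF; have [[j _ Fj]|nF] := pselect ((\bigcup_i F i) x0).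
  have fF i : f (F i) = (i == j)%:R.
    rewrite /f indicE; have [->|ij] := eqVneq i j; first by rewrite mem_set.
    rewrite memNset// => Fi; move: ij => /eqP; apply.
    by apply: (tF i j) => //; exists x0.
  rewrite (_ : f _ = 1); last by rewrite /f indicE mem_set//; exists j.
  apply: cvg_near_cst; near=> n.
  have jn : (j < n)%N by near: n; exists j.+1.
  rewrite (eq_bigr _ (fun i _ => fF i)) (bigD1_seq j) ?mem_index_iota ?iota_uniq//=.
  by rewrite eqxx big1 ?addr0// => i /negPf ->.
have fF i : f (F i) = 0.
  by rewrite /f indicE memNset// => Fi; apply: nF; exists i.
rewrite (_ : f _ = 0); last by rewrite /f indicE memNset.
by apply: cvg_near_cst; apply: nearW => n; rewrite big1.
Unshelve. all: by end_near. Qed.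

Let variation_f_le B : (variation_measure f B <= \d_(x0 : borel I) B)%E.
Proof.
apply: ge_ereal_sup => _ [F [mF tF <-] <-].
have fF i : (rnorm (f (F i)))%:E = \d_(x0 : borel I) (F i).
  rewrite /f diracE indicE; case: (_ \in _); rewrite ?rnorm0//.
  by rewrite /rnorm normr1 reK1.
rewrite (eq_eseriesr (fun i _ => fF i)) measure_semi_bigcup//.
exact: bigcupT_measurable.
Qed.

Let f_tv : (variation_measure f setT < +oo)%E.
Proof. by apply: le_lt_trans (variation_f_le _) _; rewrite diracT ltry. Qed.

Let f_regular (B : set (borel I)) (eps : R) : measurable B -> 0 < eps ->
  exists C : set I, [/\ @compact I C, C `<=` B & (variation_measure f (B `\` C) < eps%:E)%E].
Proof.
move=> mB eps0; exists (B `&` [set x0]); split.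
- have [Bx|nBx] := pselect (B x0).
    by rewrite setIidr; [exact: compact_set1|move=> _ ->].
  rewrite (_ : _ `&` _ = set0); first exact: compact0.
  by apply/seteqP; split=> // x [Bx xx0]; apply: nBx; rewrite -xx0.
- exact: subIsetl.
- apply: le_lt_trans (variation_f_le _) _.
  rewrite diracE memNset ?lte_fin// => -[Bx0]; apply.
  by split.
Qed.

Definition radon_dirac : M := RadonMeasure f0 f_sigma f_tv f_regular.

End dirac.

Section add.
Variables mu nu : M.
Let f (B : set (borel I)) : K := mu B + nu B.

Let f0 : f set0 = 0. Proof. by rewrite /f !mval0 addr0. Qed.

Let f_sigma (F : (set (borel I))^nat) :
  (forall i, measurable (F i)) -> trivIset setT F ->
  (fun n => \sum_(0 <= i < n) f (F i)) @ \oo --> f (\bigcup_i F i).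
Proof.
move=> mF tF; under eq_fun do rewrite big_split.
by apply: cvgD; exact: mval_sigma.
Qed.

Let f_tv : (variation_measure f setT < +oo)%E.
Proof.
by apply: le_lt_trans (variationD _ _ _) _; apply: lte_add_pinfty; exact: mval_tv.
Qed.

Let f_regular (B : set (borel I)) (eps : R) : measurable B -> 0 < eps ->
  exists C : set I, [/\ @compact I C, C `<=` B & (variation_measure f (B `\` C) < eps%:E)%E].
Proof.
move=> mB eps0; have eps20 : 0 < eps / 2 by rewrite divr_gt0.
have [C1 [cC1 C1B muC1]] := mval_regular mu mB eps20.
have [C2 [cC2 C2B nuC2]] := mval_regular nu mB eps20.
exists (C1 `|` C2); split.
- exact: compactU.
- by move=> x [/C1B|/C2B].
- have mC1 := compact_borel cC1; have mC2 := compact_borel cC2.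
  apply: le_lt_trans (variationD _ _ _) _.
  rewrite (splitr eps) EFinD; apply: lteD.
  + apply: le_lt_trans muC1; apply: variation_mono.
    * by apply: measurableD => //; exact: measurableU.
    * exact: measurableD.
    * by move=> x [Bx nC]; split=> // C1x; apply: nC; left.
  + apply: le_lt_trans nuC2; apply: variation_mono.
    * by apply: measurableD => //; exact: measurableU.
    * exact: measurableD.
    * by move=> x [Bx nC]; split=> // C2x; apply: nC; right.
Qed.

Definition radon_add : M := RadonMeasure f0 f_sigma f_tv f_regular.

End add.

Section scale.
Variables (c : K) (mu : M).
Let f (B : set (borel I)) : K := c * mu B.

Let f0 : f set0 = 0. Proof. by rewrite /f mval0 mulr0. Qed.

Let f_sigma (F : (set (borel I))^nat) :
  (forall i, measurable (F i)) -> trivIset setT F ->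
  (fun n => \sum_(0 <= i < n) f (F i)) @ \oo --> f (\bigcup_i F i).
Proof.
move=> mF tF; under eq_fun do rewrite -mulr_sumr.
by apply: cvgM; [exact: cvg_cst|exact: mval_sigma].
Qed.

Let variation_f_le (B : set (borel I)) (e : R) :
  (variation_measure mu B < e%:E -> variation_measure f B <= (rnorm c * e)%:E)%E.
Proof.
move=> /ltW mue; apply: le_trans (variationZ _ _ _) _.
by rewrite EFinM; apply: lee_wpmul2l; rewrite ?lee_fin ?rnorm_ge0.
Qed.

Let f_tv : (variation_measure f setT < +oo)%E.
Proof.
have : (variation_measure mu setT < +oo)%E by exact: mval_tv.
case E : (variation_measure mu setT) => [r| |] // _; last first.
  apply: (@le_lt_trans _ _ (rnorm c * 0)%:E); last exact: ltry.
  by apply: variation_f_le; rewrite E ltNyr.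
apply: (@le_lt_trans _ _ (rnorm c * (r + 1))%:E); last exact: ltry.
by apply: variation_f_le; rewrite E lte_fin ltrDl.
Qed.

Let f_regular (B : set (borel I)) (eps : R) : measurable B -> 0 < eps ->
  exists C : set I, [/\ @compact I C, C `<=` B & (variation_measure f (B `\` C) < eps%:E)%E].
Proof.
move=> mB eps0; have c1 : 0 < rnorm c + 1 by rewrite ltr_wpDl// rnorm_ge0.
have e0 : 0 < eps / (rnorm c + 1) by rewrite divr_gt0.
have [C [cC CB muC]] := mval_regular mu mB e0.
exists C; split=> //; apply: le_lt_trans (variation_f_le muC) _.
by rewrite lte_fin mulrCA gtr_pMr// ltr_pdivrMr// mul1r ltrDl.
Qed.

Definition radon_scale : M := RadonMeasure f0 f_sigma f_tv f_regular.

End scale.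

End radon_measure_operations.

Section charge_parts.
Variables (R : realType) (k : scalars) (I : pmetricType R).
Variable mu : radon_measure k I.

Definition re_charge (B : set (borel I)) : \bar R := (reK (mu B))%:E.
Definition im_charge (B : set (borel I)) : \bar R := (imK (mu B))%:E.

Let re_charge0 : re_charge set0 = 0%E.
Proof. by rewrite /re_charge mval0 reK0. Qed.

Let re_charge_fin B : measurable B -> re_charge B \is a fin_num.
Proof. by []. Qed.

Let re_charge_sigma : semi_sigma_additive re_charge.
Proof.
move=> F mF tF _; apply: cvg_EFin; first by apply: nearW => n; rewrite sumEFin.
rewrite (_ : _ \o _ = fun n => reK (\sum_(0 <= i < n) mu (F i))).
  by apply: cvg_reK; exact: mval_sigma.
by apply/funext => n; rewrite /= sumEFin/= (big_morph _ (@reKD R k) (reK0 R k)).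
Qed.

HB.instance Definition _ := isCharge.Build _ _ _ re_charge
  re_charge0 re_charge_fin re_charge_sigma.

Let im_charge0 : im_charge set0 = 0%E.
Proof. by rewrite /im_charge mval0 imK0. Qed.

Let im_charge_fin B : measurable B -> im_charge B \is a fin_num.
Proof. by []. Qed.

Let im_charge_sigma : semi_sigma_additive im_charge.
Proof.
move=> F mF tF _; apply: cvg_EFin; first by apply: nearW => n; rewrite sumEFin.
rewrite (_ : _ \o _ = fun n => imK (\sum_(0 <= i < n) mu (F i))).
  by apply: cvg_imK; exact: mval_sigma.
by apply/funext => n; rewrite /= sumEFin/= (big_morph _ (@imKD R k) (imK0 R k)).
Qed.

HB.instance Definition _ := isCharge.Build _ _ _ im_charge
  im_charge0 im_charge_fin im_charge_sigma.

End charge_parts.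

Section charge_integral.
Context d (T : measurableType d) (R : realType).
Variable nu : {charge set T -> \bar R}.

Lemma hahn_sig : {PN : set T * set T | hahn_decomposition nu PN.1 PN.2}.
Proof.
by apply: cid; have [P [N PN]] := Hahn_decomposition nu; exists (P, N).
Qed.

(* The choice of the Hahn decomposition is immaterial:
   see [Hahn_decomposition_uniq]. *)
Definition charge_integral (f : T -> R) : R :=
  \int[jordan_pos (proj2_sig hahn_sig)]_x f x -
  \int[jordan_neg (proj2_sig hahn_sig)]_x f x.

End charge_integral.

Definition radon_integral (R : realType) (k : scalars) (I : pmetricType R)
    (mu : radon_measure k I) (f : I -> scalar_field R k) : scalar_field R k :=
  let re_f x := reK (f x) in let im_f x := imK (f x) in
  mkK k
    (charge_integral (re_charge mu) re_f - charge_integral (im_charge mu) im_f)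
    (charge_integral (re_charge mu) im_f + charge_integral (im_charge mu) re_f).

Definition tv_norm (R : realType) (k : scalars) (I : pmetricType R)
  (mu : radon_measure k I) : \bar R := variation_measure mu setT.

Definition radon_support (R : realType) (k : scalars) (I : pmetricType R)
    (mu : radon_measure k I) : set I :=
  [set x | forall U : set I, open U -> U x ->
    (0 < variation_measure mu (U : set (borel I)))%E].

Definition sup_norm (R : realType) (k : scalars) (I : Type)
    (f : I -> scalar_field R k) : \bar R :=
  ereal_sup [set (rnorm (f x))%:E | x in [set: I]].

Definition C0 (R : realType) (k : scalars) (I : topologicalType) :
    set (I -> scalar_field R k) :=
  [set f | continuous f /\ forall eps : R, 0 < eps ->
    exists2 C : set I, compact C & forall x, ~ C x -> rnorm (f x) < eps].

Section dictionary.
Variables (R : realType) (k : scalars) (I : pmetricType R).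
Local Notation K := (scalar_field R k).
Variables (H : completeNormedModType K) (ip : {dot H for @conjK R k}).

Definition test_map (phi : I -> H) (v : H) : I -> K := fun x => ip v (phi x).

Definition dictionary (phi : I -> H) : Prop :=
  (forall v, C0 (test_map phi v)) /\
  exists M : R, forall v, (sup_norm (test_map phi v) <= (M * rnorm v)%:E)%E.

(* In [synthesis] (for a dictionary), [adjoint] (for a bounded operator) and
   [orthoproj] (onto a closed subspace) the defining property determines exactly
   one vector, so the default value of [xget] plays no role. *)
Definition synthesis (phi : I -> H) (mu : radon_measure k I) : H :=
  xget 0 [set w | forall v, ip w v = radon_integral mu (fun x => ip (phi x) v)].

Definition atomic_norm (phi : I -> H) (v : H) : \bar R :=
  ereal_inf [set tv_norm mu | mu in [set mu | synthesis phi mu = v]].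

Definition dual_atomic_norm (Phi : set H) (v : H) : \bar R :=
  ereal_sup [set (rnorm (ip v p))%:E | p in Phi].

Definition euclidean_ip (m : nat) (p q : 'cV[K]_m) : K :=
  \sum_(i < m) p i 0 * conjK (q i 0).

Definition adjoint (m : nat) (A : H -> 'cV[K]_m) (p : 'cV[K]_m) : H :=
  xget 0 [set w | forall v, euclidean_ip (A v) p = ip v w].

Definition line (u : H) : set H := [set a *: u | a in [set: K]].

Definition orthocomplement (S : set H) : set H :=
  [set v | forall u, S u -> ip v u = 0].

Definition orthoproj (S : set H) (v : H) : H :=
  xget 0 [set w | S w /\ orthocomplement S (v - w)].

Definition tv_minimizer (m : nat) (A : H -> 'cV[K]_m) (phi : I -> H)
    (b : 'cV[K]_m) (mu : radon_measure k I) : Prop :=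
  A (synthesis phi mu) = b /\
  forall mu' : radon_measure k I,
    A (synthesis phi mu') = b -> (tv_norm mu <= tv_norm mu')%E.

End dictionary.

(* Main.v *)
(* Write [mu0 = c0 delta_{x0} + muc] and [g x = <phi_x, nu>]. As [nu] is in the
   range of [A^*] and [mu_*] is feasible, [mu0] and [mu_*] give the same integral
   of [g], of real part at least [1], while [|mu_*| <= |mu0| = 1] by minimality.
   If no [x] in the support of [mu_*] with [phi_x] in [Phi_{j0}] satisfied the
   conclusion, then [|g| < 1] would hold on this support: off [Phi_{j0}] by the
   assumption on [Phi_j], and on [Phi_{j0}] by decomposing [nu] along [phi_{x0}]
   and its orthogonal complement, since then
   [|g x| <= 1 - t + sigma |<phi_x, phi_{x0}>| < 1]. But [|g| < 1] on the support
   of a measure of total variation at most [1] forces [|int g dmu_*| < 1].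

   That [synthesis] and [adjoint] satisfy their defining properties is the Riesz
   representation theorem. *)

Require Import Defs.
From HB Require Import structures.
From mathcomp Require Import all_boot all_order all_algebra.
From mathcomp Require Import complex.
From mathcomp Require Import all_classical all_reals all_analysis.
From mathcomp Require Import measurable_realfun.
From mathcomp Require Import ring lra.

Set Implicit Arguments.
Unset Strict Implicit.
Unset Printing Implicit Defensive.

Import Order.TTheory GRing.Theory Num.Theory.
Import numFieldNormedType.Exports.

Local Open Scope classical_set_scope.
Local Open Scope ring_scope.

(** * Scalars *)

Section scalar_theory.
Variables (R : realType) (k : scalars).
Local Notation K := (scalar_field R k).
Implicit Types x y : K.

Lemma reKM x y : reK (x * y) = reK x * reK y - imK x * imK y.
Proof. by case: k x y => /= [x y|[? ?] [? ?]] //; rewrite mulr0 subr0. Qed.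

Lemma imKM x y : imK (x * y) = reK x * imK y + imK x * reK y.
Proof.
by case: k x y => /= [x y|[? ?] [? ?]] //; rewrite mulr0 mul0r addr0.
Qed.

Lemma imK1 : imK (1 : K) = 0. Proof. by case: k. Qed.

(** Reduces imaginary parts to real parts of a multiple of [x], so an identity of [K]-linear forms
    only has to be checked on real parts. For real scalars [mkK k 0 1] is [0] and both sides
    vanish. *)
Lemma imKE x : imK x = - reK (mkK k 0 1 * x).
Proof.
by case: k x => [x|[a b]] /=; rewrite ?mul0r ?oppr0// sub0r mul1r opprK.
Qed.

Lemma eqK x y : reK x = reK y -> imK x = imK y -> x = y.
Proof. by case: k x y => /= [//|[? ?] [? ?]] /= -> ->. Qed.

Lemma reK_conj x : reK (conjK x) = reK x.
Proof. by case: k x => //= -[]. Qed.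

Lemma imK_conj x : imK (conjK x) = - imK x.
Proof. by case: k x => /= [_|[]] //; rewrite oppr0. Qed.

Lemma imK_mkK (a b : R) :
  imK (mkK k a b) = if k is ComplexScalars then b else 0.
Proof. by case: k. Qed.

Lemma imK_mkK0 (a : R) : imK (mkK k a 0) = 0.
Proof. by case: k. Qed.

Lemma conjKD x y : conjK (x + y) = conjK x + conjK y.
Proof. by apply: eqK; rewrite ?(reKD, imKD, reK_conj, imK_conj)// opprD. Qed.

Lemma conjKM x y : conjK (x * y) = conjK x * conjK y.
Proof.
by apply: eqK; rewrite !(reKM, imKM, reK_conj, imK_conj); ring.
Qed.

Lemma conjKK : involutive (@conjK R k).
Proof. by move=> x; apply: eqK; rewrite !(reK_conj, imK_conj)// opprK. Qed.

Lemma rnorm_sqr x : rnorm x ^+ 2 = reK x ^+ 2 + imK x ^+ 2.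
Proof.
case: k x => [x|[a b]]; rewrite /rnorm /=.
  by rewrite expr0n addr0 real_normK// num_real.
by rewrite sqr_sqrtr// addr_ge0 ?sqr_ge0.
Qed.

Lemma rnorm_conj x : rnorm (conjK x) = rnorm x.
Proof.
apply/eqP; rewrite -(eqrXn2 (n := 2))// ?rnorm_ge0//.
by rewrite !rnorm_sqr reK_conj imK_conj sqrrN.
Qed.

Lemma rnorm_mkK0 (a : R) : rnorm (mkK k a 0) = `|a|.
Proof.
apply/eqP; rewrite -(eqrXn2 (n := 2))// ?rnorm_ge0//.
by rewrite rnorm_sqr reK_mkK imK_mkK0 expr0n addr0 real_normK// num_real.
Qed.

Lemma rnorm_le_reim x : rnorm x <= `|reK x| + `|imK x|.
Proof.
rewrite -(ler_pXn2r (n := 2))// ?nnegrE ?rnorm_ge0 ?addr_ge0// rnorm_sqr.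
rewrite sqrrD !real_normK ?num_real//.
by rewrite lerD2r lerDl mulrn_wge0// mulr_ge0.
Qed.

Lemma imK_norm (V : normedZmodType K) (v : V) : imK `|v| = 0.
Proof.
suff im0 x : 0 <= x -> imK x = 0 by exact/im0/normr_ge0.
by case: k x => //= -[a b]; rewrite lecE /= => /andP[/eqP].
Qed.

Lemma rnorm_eq0 (V : normedZmodType K) (v : V) : rnorm v = 0 -> v = 0.
Proof.
move=> v0; apply/eqP; rewrite -normr_eq0; apply/eqP.
by apply: eqK; rewrite ?imK_norm ?imK0 ?reK0.
Qed.

Lemma rnormZ (V : normedModType K) x (v : V) :
  rnorm (x *: v) = rnorm x * rnorm v.
Proof. by rewrite /rnorm normrZ reKM !imK_norm mul0r subr0. Qed.

Lemma rnormB (V : normedZmodType K) (v w : V) : rnorm (v - w) = rnorm (w - v).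
Proof. by rewrite /rnorm distrC. Qed.

Lemma mkK_gt0 (e : R) : 0 < e -> 0 < mkK k e 0.
Proof. by case: k => //= e0; rewrite ltcE /= eqxx e0. Qed.

Lemma gt0_reK x : 0 < x -> 0 < reK x /\ x = mkK k (reK x) 0.
Proof.
case: k x => //= -[a b]; rewrite ltcE /= => /andP[/eqP b0 a0]; split => //.
by rewrite b0.
Qed.

Lemma ltK_mkK0 x (a : R) : imK x = 0 -> (x < mkK k a 0) = (reK x < a).
Proof.
by case: k x => //= -[? ?] /= ->; rewrite ltcE /= eqxx.
Qed.

(** The bridge from the [K]-valued order, in which balls and limits are phrased, to real estimates:
    a positive element of [K] is real, and so is a norm. *)
Lemma rnorm_lt (V : normedZmodType K) (v : V) x :
  0 < x -> (`|v| < x) = (rnorm v < reK x).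
Proof.
by move=> /gt0_reK [x0 ->]; rewrite reK_mkK ltK_mkK0// imK_norm.
Qed.

Lemma cvg_rnormP (V : normedModType K) (u : nat -> V) (l : V) :
  u @ \oo --> l ->
  forall eps : R, 0 < eps -> \forall n \near \oo, rnorm (l - u n) < eps.
Proof.
move=> /cvgrPdist_lt ul eps eps0.
apply: filterS (ul _ (mkK_gt0 eps0)) => n.
by rewrite rnorm_lt ?mkK_gt0// reK_mkK.
Qed.

Lemma continuous_reK (T : topologicalType) (f : T -> K) :
  continuous f -> continuous (fun p => reK (f p)).
Proof.
move=> cf x; apply/cvgrPdist_lt => eps eps0.
have /cvgrPdist_lt /(_ _ (mkK_gt0 eps0)) := cf x.
apply: filterS => y; rewrite rnorm_lt ?mkK_gt0// reK_mkK; apply: le_lt_trans.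
by rewrite -reKN -reKD; exact: normr_reK_le.
Qed.

Lemma continuous_imK (T : topologicalType) (f : T -> K) :
  continuous f -> continuous (fun p => imK (f p)).
Proof.
move=> cf x; apply/cvgrPdist_lt => eps eps0.
have /cvgrPdist_lt /(_ _ (mkK_gt0 eps0)) := cf x.
apply: filterS => y; rewrite rnorm_lt ?mkK_gt0// reK_mkK; apply: le_lt_trans.
by rewrite -imKN -imKD; exact: normr_imK_le.
Qed.

Lemma ler_rdist_dist (V : normedZmodType K) (v w : V) :
  `|rnorm v - rnorm w| <= rnorm (v - w).
Proof.
rewrite ler_norml; apply/andP; split.
  rewrite lerNl opprB lerBlDr rnormB; apply: le_trans (ler_rnormD _ _).
  by rewrite subrK.
by rewrite lerBlDr; apply: le_trans (ler_rnormD _ _); rewrite subrK.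
Qed.

Lemma continuous_rnorm (T : topologicalType) (V : normedModType K)
    (f : T -> V) :
  continuous f -> continuous (fun p => rnorm (f p)).
Proof.
move=> cf x; apply/cvgrPdist_lt => eps eps0.
have /cvgrPdist_lt /(_ _ (mkK_gt0 eps0)) := cf x.
apply: filterS => y; rewrite rnorm_lt ?mkK_gt0// reK_mkK; apply: le_lt_trans.
exact: ler_rdist_dist.
Qed.

Lemma mkKE (x : K) : mkK k (reK x) (imK x) = x.
Proof. by case: k x => //= -[]. Qed.

Lemma mkKD (a b a' b' : R) : mkK k a b + mkK k a' b' = mkK k (a + a') (b + b').
Proof. by case: k. Qed.

Lemma mkKB (a b a' b' : R) : mkK k a b - mkK k a' b' = mkK k (a - a') (b - b').
Proof. by case: k. Qed.

Lemma mulK_mkK (c : K) (a b : R) :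
  c * mkK k a b = mkK k (reK c * a - imK c * b) (reK c * b + imK c * a).
Proof. by case: k c => [c|[? ?]] //=; rewrite mul0r subr0. Qed.

Lemma rnorm_mkK_le (a b : R) : rnorm (mkK k a b) <= `|a| + `|b|.
Proof.
apply: le_trans (rnorm_le_reim _) _; rewrite reK_mkK imK_mkK lerD2l.
by case: (k); rewrite ?normr0.
Qed.

End scalar_theory.

(** * Riesz representation *)

Section hilbert.
Variables (R : realType) (k : scalars).
Local Notation K := (scalar_field R k).
Variables (H : completeNormedModType K) (ip : {dot H for @conjK R k}).
Hypothesis ip_norm : forall v : H, ip v v = `|v| ^+ 2.
Implicit Types u v w : H.

Lemma ipC u v : ip u v = conjK (ip v u).
Proof. by rewrite (hermitian_subproof (s := ip) u v) expr0 mul1r. Qed.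

Lemma ipBl u v w : ip (u - v) w = ip u w - ip v w.
Proof. exact: linearBl. Qed.

Lemma ipDl u v w : ip (u + v) w = ip u w + ip v w.
Proof. by apply/eqP; rewrite -subr_eq -ipBl addrK. Qed.

Lemma ipZl a u v : ip (a *: u) v = a * ip u v.
Proof. exact: linearZl_LR. Qed.

Lemma ipDr u v w : ip u (v + w) = ip u v + ip u w.
Proof. by rewrite ipC ipDl conjKD -!ipC. Qed.

Lemma ipZr a u v : ip u (a *: v) = conjK a * ip u v.
Proof. by rewrite ipC ipZl conjKM -ipC. Qed.

Lemma rnorm_ipC u v : rnorm (ip u v) = rnorm (ip v u).
Proof. by rewrite ipC rnorm_conj. Qed.

Lemma reK_ip v : reK (ip v v) = rnorm v ^+ 2.
Proof. by rewrite ip_norm expr2 reKM imK_norm mul0r subr0 -expr2. Qed.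

Lemma rnorm_sqrD u v :
  rnorm (u + v) ^+ 2 = rnorm u ^+ 2 + rnorm v ^+ 2 + 2 * reK (ip v u).
Proof.
rewrite -!reK_ip ipDl !ipDr !reKD (ipC u v) reK_conj; ring.
Qed.

Lemma parallelogram u v :
  rnorm (u + v) ^+ 2 + rnorm (u - v) ^+ 2 = 2 * (rnorm u ^+ 2 + rnorm v ^+ 2).
Proof.
rewrite !rnorm_sqrD -!reK_ip -scaleN1r !(ipZl, ipZr) !reKM.
rewrite !(reK_conj, imK_conj, reKN, imKN, reK1, imK1).
ring.
Qed.

Section riesz.
Variables (l : H -> K) (C : R).
Hypotheses (lD : forall u v, l (u + v) = l u + l v)
  (lZ : forall a v, l (a *: v) = a * l v)
  (lC : forall v, rnorm (l v) <= C * rnorm v).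

(* The Riesz vector is the minimizer of this energy, and the parallelogram
   identity makes minimizing sequences Cauchy. *)
Let J v : R := rnorm v ^+ 2 - 2 * reK (l v).
Let mkR (a : R) : K := mkK k a 0.

Let mkRZ a v : rnorm (mkR a *: v) = `|a| * rnorm v.
Proof. by rewrite rnormZ rnorm_mkK0. Qed.

Let re_lZ a v : reK (l (mkR a *: v)) = a * reK (l v).
Proof. by rewrite lZ reKM reK_mkK imK_mkK0 mul0r subr0. Qed.

Let re_ipZ a u v : reK (ip (mkR a *: u) v) = a * reK (ip u v).
Proof. by rewrite ipZl reKM reK_mkK imK_mkK0 mul0r subr0. Qed.

(** Completing the square: [J v] is at least [(rnorm v - C) ^+ 2 - C ^+ 2]. *)
Let J_ge v : - C ^+ 2 <= J v.
Proof.
rewrite /J; have := lC v; have := normr_reK_le (l v).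
by rewrite ler_norml => /andP[_]; have := sqr_ge0 (rnorm v - C); nra.
Qed.

Let has_inf_J : has_inf (range J).
Proof.
by split; [exists (J 0), 0|exists (- C ^+ 2) => _ [v _ <-]; exact: J_ge].
Qed.

Let m := inf (range J).

Let J_inf v : m <= J v.
Proof. by apply: ge_inf; [exact: has_inf_J.2|exists v]. Qed.

(** The energy of the midpoint of [u] and [v] is at least [m]; the parallelogram identity turns this
    into a bound on their distance. *)
Let J_mid u v : rnorm (u - v) ^+ 2 <= 2 * (J u + J v - 2 * m).
Proof.
have := J_inf (mkR 2^-1 *: (u + v)); rewrite /J mkRZ re_lZ lD reKD.
rewrite ger0_norm ?invr_ge0// exprMn.
by have := parallelogram u v; nra.
Qed.

Let minimizing : exists v_ : nat -> H, forall n, J (v_ n) < m + n.+1%:R^-1.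
Proof.
suff /choice[v_] : forall n, exists v, J v < m + n.+1%:R^-1 by exists v_.
move=> n.
have n0 : 0 < (n.+1%:R^-1 : R) by rewrite invr_gt0.
have [_ [v _ <-] Jv] := inf_adherent n0 has_inf_J.
by exists v.
Qed.

Let minimizer : exists w, J w = m.
Proof.
have [v_ vP] := minimizing.
have : cvg (v_ @ \oo).
  apply/cauchy_cvgP; apply: cauchy_exP => e /gt0_reK [e0 ->].
  set d := reK e in e0 *.
  (* Two energies within [d ^+ 2 / 4] of [m] give by [J_mid] a squared distance below
     [2 * (d ^+ 2 / 4 + d ^+ 2 / 4) = d ^+ 2]. *)
  have d0 : 0 < d ^+ 2 / 4 by rewrite divr_gt0// exprn_gt0.
  have [N _ NP] : \forall n \near \oo, (n.+1%:R^-1 : R) < d ^+ 2 / 4.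
    exact: near_infty_natSinv_lt (PosNum d0).
  exists (v_ N); exists N => //= n Nn.
  rewrite -ball_normE /= rnorm_lt ?mkK_gt0// reK_mkK.
  rewrite -(ltr_pXn2r (n := 2))// ?nnegrE ?rnorm_ge0//; last exact: ltW.
  apply: le_lt_trans (J_mid _ _) _.
  move: (vP n) (vP N) (NP n Nn) (NP N (leqnn N)) => /=.
  by move: (J (v_ n)) (J (v_ N)) n.+1%:R^-1 N.+1%:R^-1 => *; lra.
set w := lim (v_ @ \oo) => vw; exists w; apply/eqP; rewrite eq_le J_inf andbT.
have {vw} := cvg_rnormP vw; rewrite -/w => vw.
have cre : (fun n => reK (l (v_ n))) @ \oo --> reK (l w).
  apply/cvgrPdist_lt => eps eps0.
  (* No sign is assumed on [C], hence this positive substitute as a Lipschitz constant. *)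
  have C0 : 0 < `|C| + 1 by rewrite ltr_wpDl.
  apply: filterS (vw _ (divr_gt0 eps0 C0)) => n; rewrite ltr_pdivlMr// => vn.
  rewrite -reKN -reKD; apply: le_lt_trans (normr_reK_le _) _.
  have -> : l w - l (v_ n) = l (w - v_ n).
    by rewrite -[- v_ n]scaleN1r lD lZ mulN1r.
  apply: le_lt_trans (lC _) _; apply: le_lt_trans vn; rewrite mulrC.
  by apply: ler_wpM2l; rewrite ?rnorm_ge0// (le_trans (ler_norm C))// lerDl.
have cn : (fun n => rnorm (v_ n)) @ \oo --> rnorm w.
  apply/cvgrPdist_lt => eps eps0; apply: filterS (vw _ eps0) => n.
  by apply: le_lt_trans; exact: ler_rdist_dist.
have cJ : (fun n => J (v_ n)) @ \oo --> J w.
  by apply: cvgB; [exact: cvgM|apply: cvgM => //; exact: cvg_cst].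
have cm : (fun n => m + n.+1%:R^-1) @ \oo --> m + 0.
  by apply: cvgD; [exact: cvg_cst|exact: cvg_harmonic].
rewrite addr0 in cm.
rewrite -(cvg_lim _ cJ)// -(cvg_lim _ cm)//; apply: ler_lim.
- by apply/cvg_ex; exists (J w).
- by apply/cvg_ex; exists m.
- by apply: nearW => n; exact/ltW.
Qed.

(** First variation at the minimizer [w]: if the real parts differed by [a] at some [v], a small
    real step along [v] would lower the energy. Imaginary parts follow by [imKE]. *)
Lemma riesz : exists w, forall v, ip v w = l v.
Proof.
have [w wm] := minimizer; exists w.
have re v : reK (ip v w) = reK (l v).
  set a := reK (ip v w) - reK (l v).
  suff /eqP : a ^+ 2 = 0 by rewrite sqrf_eq0 subr_eq0 => /eqP.
  (* The step is [s = - a / q]. It changes the energy by [2 * s * a + s ^+ 2 * rnorm v ^+ 2 = - (a /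
     q) ^+ 2 * (rnorm v ^+ 2 + 2)]; the summand [1] keeps [q] nonzero at [v = 0]. *)
  set q := rnorm v ^+ 2 + 1.
  have q1 : 1 <= q by rewrite lerDr sqr_ge0.
  have q0 : q != 0 by rewrite gt_eqF// (lt_le_trans _ q1).
  have := J_inf (w + mkR (- a / q) *: v); rewrite -wm /J.
  rewrite lD reKD re_lZ rnorm_sqrD re_ipZ mkRZ exprMn real_normK ?num_real//.
  rewrite -subr_ge0.
  rewrite (_ : _ - _ = (- (a / q) ^+ 2) * (rnorm v ^+ 2 + 2)); last first.
    by rewrite /a /q; field.
  rewrite mulNr oppr_ge0 pmulr_lle0; last first.
    by rewrite ltr_wpDl// sqr_ge0.
  move=> aq; have /eqP : (a / q) ^+ 2 = 0.
    by apply/eqP; rewrite eq_le aq sqr_ge0.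
  rewrite sqrf_eq0 mulf_eq0 invr_eq0 (negPf q0) orbF => /eqP ->.
  by rewrite expr0n.
move=> v; apply: eqK => //.
by rewrite !imKE -ipZl -lZ re.
Qed.

End riesz.

End hilbert.

(** * Integration against charges *)

Section bounded_measurable.
Context d (T : measurableType d) (R : realType).
Implicit Types f g : T -> R.

Definition bounded_measurable f :=
  measurable_fun setT f /\ exists M : R, forall x, `|f x| <= M.

Lemma bounded_measurableD f g : bounded_measurable f -> bounded_measurable g ->
  bounded_measurable (fun x => f x + g x).
Proof.
move=> [mf [M fM]] [mg [N gN]]; split; first exact: measurable_funD.
by exists (M + N) => x; apply: le_trans (ler_normD _ _) _; apply: lerD.
Qed.

Lemma bounded_measurableM f g : bounded_measurable f -> bounded_measurable g ->
  bounded_measurable (fun x => f x * g x).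
Proof.
move=> [mf [M fM]] [mg [N gN]]; split; first exact: measurable_funM.
by exists (M * N) => x; rewrite normrM; apply: ler_pM.
Qed.

Lemma bounded_measurable_cst (a : R) : bounded_measurable (cst a).
Proof. by split; [exact: measurable_cst|exists `|a|]. Qed.

Lemma bounded_measurableZ (a : R) f : bounded_measurable f ->
  bounded_measurable (fun x => a * f x).
Proof. by apply: bounded_measurableM; exact: bounded_measurable_cst. Qed.

Lemma bounded_measurable_indic (E : set T) : measurable E ->
  bounded_measurable (\1_E : T -> R).
Proof.
move=> mE; split; first exact: measurable_indic.
by exists 1 => x; rewrite indicE; case: (_ \in _); rewrite ?normr0 ?normr1.
Qed.

Lemma bounded_measurable_integrable (m : {finite_measure set T -> \bar R}) f :
  bounded_measurable f -> m.-integrable setT (EFin \o f).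
Proof.
move=> [mf [M fM]]; apply: measurable_bounded_integrable => //.
  by rewrite ltey_eq fin_num_measure.
by exists M; split; [exact: num_real|move=> y My x _; exact: le_trans (ltW My)].
Qed.

Lemma normr_Rintegral_le (m : {finite_measure set T -> \bar R}) f (M : R) :
  bounded_measurable f -> (forall x, `|f x| <= M) ->
  `|\int[m]_x f x| <= M * fine (m setT).
Proof.
move=> bf fM; have intf := bounded_measurable_integrable m bf.
apply: le_trans (le_normr_Rintegral _ intf) _ => //.
rewrite -Rintegral_cst//; apply: le_Rintegral => //.
- have [mf _] := bf.
  apply: bounded_measurable_integrable; split; first exact: measurableT_comp.
  by exists M => x; rewrite normr_id.
- by apply: bounded_measurable_integrable; exact: bounded_measurable_cst.
Qed.

End bounded_measurable.

Section charge_integral_theory.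
Context d (T : measurableType d) (R : realType).
Variable nu : {charge set T -> \bar R}.
Implicit Types f g : T -> R.

Lemma charge_integralD f g : bounded_measurable f -> bounded_measurable g ->
  charge_integral nu (fun x => f x + g x) =
  charge_integral nu f + charge_integral nu g.
Proof.
move=> bf bg; rewrite /charge_integral.
rewrite !RintegralD//; try exact: bounded_measurable_integrable.
ring.
Qed.

Lemma charge_integralZ (a : R) f : bounded_measurable f ->
  charge_integral nu (fun x => a * f x) = a * charge_integral nu f.
Proof.
move=> bf; rewrite /charge_integral.
by rewrite !RintegralZl ?mulrBr//; exact: bounded_measurable_integrable.
Qed.

(** The Jordan decomposition writes [nu E] as the difference of its two parts, whichever Hahn
    decomposition was chosen. *)
Lemma charge_integral_indic (E : set T) : measurable E ->
  charge_integral nu (\1_E) = fine (nu E).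
Proof.
move=> mE; rewrite /charge_integral /Rintegral.
rewrite !integral_indic// !setIT.
rewrite (jordan_decomp (proj2_sig (hahn_sig nu)) mE) /cadd /= cscaleN1.
by rewrite fineB// fin_num_measure.
Qed.

Lemma charge_integral_bound : exists2 C : R, 0 <= C & forall f (M : R),
  bounded_measurable f -> (forall x, `|f x| <= M) ->
  `|charge_integral nu f| <= C * M.
Proof.
set P := jordan_pos (proj2_sig (hahn_sig nu)).
set N := jordan_neg (proj2_sig (hahn_sig nu)).
exists (fine (P setT) + fine (N setT)).
  by rewrite addr_ge0// fine_ge0.
move=> f M bf fM; rewrite /charge_integral -/P -/N.
apply: le_trans (ler_normB _ _) _; rewrite mulrC mulrDr.
by apply: lerD; exact: normr_Rintegral_le.
Qed.

End charge_integral_theory.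

(** * Total variation *)

Section variation_superadditive.
Context d (T : measurableType d) (R : realType) (k : scalars).
Local Notation K := (scalar_field R k).
Variable mu : set T -> K.
Local Open Scope ereal_scope.
Implicit Types A B E : set T.

Lemma variation_ge_partition E (F : (set T)^nat) :
  (forall i, measurable (F i)) -> trivIset setT F -> \bigcup_i F i = E ->
  \sum_(0 <= i <oo) (rnorm (mu (F i)))%:E <= variation_measure mu E.
Proof. by move=> *; apply: ereal_sup_ubound; exists F. Qed.

Lemma variation_measure_ge0 E : measurable E -> 0 <= variation_measure mu E.
Proof.
move=> mE; apply: le_trans (_ : _ <= _); last first.
  (* A supremum over no partition would be [-oo], so one partition of [E] has to be exhibited. *)
  apply: (variation_ge_partition (F := fun i => if i is 0%N then E else set0)).
  - by case.
  - by apply/trivIsetP => -[|i] [|j] //= _ _ _; rewrite ?setI0 ?set0I.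
  - by apply/seteqP; split=> [x [[|i] _]//|x Ex]; exists 0%N.
by apply: nneseries_ge0 => i _ _; rewrite lee_fin rnorm_ge0.
Qed.

(** Prepending [A] to any partition of [B] gives a partition of the union. The term of [A] is
    finite, so it can be moved across before taking the supremum. *)
Lemma variation_superadditive1 A B : measurable A -> measurable B ->
  A `&` B = set0 ->
  (rnorm (mu A))%:E + variation_measure mu B <= variation_measure mu (A `|` B).
Proof.
move=> mA mB AB; rewrite -leeBrDl//; apply: ge_ereal_sup => _ [F [mF tF FB] <-].
rewrite leeBrDl//; pose G i := if i is n.+1 then F n else A.
have G0 i : 0 <= (rnorm (mu (G i)))%:E by rewrite lee_fin rnorm_ge0.
have -> : (rnorm (mu A))%:E + \sum_(0 <= i <oo) (rnorm (mu (F i)))%:E =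
          \sum_(0 <= i <oo) (rnorm (mu (G i)))%:E.
  rewrite [RHS]nneseries_recl//; congr (_ + _).
  rewrite -[RHS]nneseries_addn//.
  by apply: eq_eseriesr => i _; rewrite addn1.
apply: variation_ge_partition.
- by case.
- apply/trivIsetP => -[|i] [|j] //= _ _ ij.
  + apply/seteqP; split=> // x [Ax Fx].
    by rewrite -AB -FB; split=> //; exists j.
  + apply/seteqP; split=> // x [Fx Ax].
    by rewrite -AB -FB; split=> //; exists i.
  + by move/trivIsetP : tF; exact.
- rewrite -FB; apply/seteqP; split=> [x [[|i] _ /=]|x [Ax|[i _ Fx]]].
  + by left.
  + by move=> Fx; right; exists i.
  + by exists 0%N.
  + by exists i.+1.
Qed.

Lemma variation_superadditive_seq (J : choiceType) (s : seq J)
    (E : J -> set T) B :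
  uniq s -> (forall j, measurable (E j)) -> trivIset setT E ->
  measurable B -> (forall j, j \in s -> E j `&` B = set0) ->
  \sum_(j <- s) (rnorm (mu (E j)))%:E + variation_measure mu B <=
  variation_measure mu (\big[setU/set0]_(j <- s) E j `|` B).
Proof.
move=> + mE tE mB; elim: s => [_ _|j s IH /= /andP[js us] EB].
  by rewrite !big_nil add0e set0U.
rewrite !big_cons -addeA -setUA.
apply: le_trans (variation_superadditive1 (mE j) _ _).
- apply: leeD => //; apply: IH => // i si.
  by apply: EB; rewrite inE si orbT.
- by apply: measurableU => //; exact: bigsetU_measurable.
- rewrite setIUr EB ?mem_head// setU0; apply/seteqP; split=> // x [Ejx].
  rewrite -bigcup_seq => -[i /= si Eix].
  by move: js; rewrite (tE j i)// ?si//; exists x.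
Qed.

(** Partitions in the variation are sequences that exhaust the set. Peeling off the pieces one by
    one covers finite families, and monotonicity those that do not fill [B]. *)
Lemma sum_le_variation (J : finType) (E : J -> set T) B :
  (forall j, measurable (E j)) -> trivIset setT E ->
  measurable B -> (forall j, E j `<=` B) ->
  \sum_(j : J) (rnorm (mu (E j)))%:E <= variation_measure mu B.
Proof.
move=> mE tE mB EB.
have mU : measurable (\big[setU/set0]_(j : J) E j) by exact: bigsetU_measurable.
apply: le_trans (_ : _ <= variation_measure mu (\big[setU/set0]_(j : J) E j)) _.
  rewrite -[leLHS]adde0 -[X in variation_measure _ X]setU0.
  have := variation_superadditive_seq (index_enum_uniq J) mE tE measurable0.
  move=> /(_ (fun j _ => setI0 _)); apply: le_trans.
  by rewrite leeD2l//; exact: variation_measure_ge0.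
apply: variation_mono => //; rewrite -bigcup_seq.
by apply: bigcup_sub => j _; exact: EB.
Qed.

(** For a partition of [A], each partial sum plus the variation of [B] is at most the variation of
    the union. The limit and then the supremum are taken with the finite variation of [B] moved to
    the right. *)
Lemma variation_superadditive A B : measurable A -> measurable B ->
  A `&` B = set0 -> variation_measure mu B \is a fin_num ->
  variation_measure mu A + variation_measure mu B <=
  variation_measure mu (A `|` B).
Proof.
move=> mA mB AB fB; rewrite -leeBrDr//.
apply: ge_ereal_sup => _ [F [mF tF FA] <-].
apply: lime_le.
  by apply: is_cvg_nneseries => i _ _; rewrite lee_fin rnorm_ge0.
apply: nearW => n; rewrite leeBrDr//.
have FsubA i : F i `<=` A by rewrite -FA => x Fx; exists i.
apply: le_trans (variation_superadditive_seq (iota_uniq 0 _) mF tF mB _) _.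
  by move=> i _; apply/seteqP; split=> // x [/FsubA Ax Bx]; rewrite -AB.
apply: variation_mono.
- by apply: measurableU => //; exact: bigsetU_measurable.
- exact: measurableU.
- rewrite -bigcup_seq => x [[i _ /FsubA]|]; first by left.
  by right.
Qed.

End variation_superadditive.

(* Rounds down to a multiple of [eps]. *)
Lemma bounded_measurable_quantize d (T : measurableType d) (R : realType)
    (u : T -> R) (eps : R) : bounded_measurable u -> 0 < eps ->
  exists N (q : T -> 'I_N) (c : 'I_N -> R),
    (forall j, measurable (q @^-1` [set j])) /\
    forall x, `|u x - c (q x)| <= eps.
Proof.
move=> [mu [M uM]] eps0; pose v x := (u x + M) / eps.
have v0 x : 0 <= v x.
  apply: divr_ge0; last exact: ltW.
  by have := uM x; rewrite ler_norml => /andP[]; lra.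
have vM x : v x <= 2 * M / eps.
  rewrite ler_pM2r ?invr_gt0//; have := uM x.
  by rewrite ler_norml => /andP[_]; lra.
set N := Num.truncn (2 * M / eps).
have vN x : (Num.truncn (v x) < N.+1)%N by rewrite ltnS; exact: le_truncn.
(* [v] ranges in [[0, 2 * M / eps]], so its integer part is one of [0, ..., N]; [c j] is the lower
   end of the cell of [u] with index [j]. *)
exists N.+1, (fun x => inord (Num.truncn (v x))), (fun j => j%:R * eps - M).
split.
  move=> j.
  have -> : (fun x => inord (Num.truncn (v x))) @^-1` [set j] =
            setT `&` v @^-1` [set` `[j%:R, j.+1%:R[ ].
    apply/seteqP; split=> x /=; rewrite in_itv /=.
      move=> /(congr1 val) /=; rewrite inordK// => jE; split => //.
      by rewrite -truncn_eq// jE.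
    move=> [_]; rewrite -truncn_eq// => /eqP vj.
    by apply: val_inj; rewrite /= inordK.
  have mv : measurable_fun setT v.
    by apply: measurable_funM => //; apply: measurable_funD.
  exact: mv.
move=> x; rewrite inordK//.
have -> : u x = v x * eps - M by rewrite divfK ?addrK// gt_eqF.
rewrite opprB addrA subrK -mulrBl normrM (gtr0_norm eps0) ger_pMl//.
have /andP[tv vt] := truncn_itv (v0 x).
rewrite ger0_norm ?subr_ge0//.
by move: vt; rewrite -natr1; lra.
Qed.

(** * Integration against Radon measures *)

Section radon_integral_theory.
Variables (R : realType) (k : scalars) (I : pmetricType R).
Local Notation K := (scalar_field R k).
Variable mu : radon_measure k I.
Implicit Types (f g : borel I -> K) (E : set (borel I)).

Definition bounded_measurableK f :=
  bounded_measurable (fun x => reK (f x)) /\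
  bounded_measurable (fun x => imK (f x)).

Lemma bounded_measurableKD f g :
  bounded_measurableK f -> bounded_measurableK g ->
  bounded_measurableK (fun x => f x + g x).
Proof.
move=> [fre fim] [gre gim]; split.
  by under eq_fun do rewrite reKD; exact: bounded_measurableD.
by under eq_fun do rewrite imKD; exact: bounded_measurableD.
Qed.

Lemma bounded_measurableKM f g :
  bounded_measurableK f -> bounded_measurableK g ->
  bounded_measurableK (fun x => f x * g x).
Proof.
move=> [fre fim] [gre gim]; split.
  under eq_fun do rewrite reKM -mulN1r mulrA.
  apply: bounded_measurableD; first exact: bounded_measurableM.
  by apply: bounded_measurableM => //; exact: bounded_measurableZ.
under eq_fun do rewrite imKM.
by apply: bounded_measurableD; exact: bounded_measurableM.
Qed.

Lemma bounded_measurableK_cst (c : K) : bounded_measurableK (cst c).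
Proof.
split; first exact: (bounded_measurable_cst _ (reK c)).
exact: (bounded_measurable_cst _ (imK c)).
Qed.

Lemma bounded_measurableK_indic E : measurable E ->
  bounded_measurableK (\1_E : borel I -> K).
Proof.
move=> mE; split.
  rewrite (_ : (fun _ => _) = \1_E); first exact: bounded_measurable_indic.
  by apply/funext => x; rewrite !indicE; case: (_ \in _); rewrite ?reK0 ?reK1.
rewrite (_ : (fun _ => _) = cst 0); first exact: bounded_measurable_cst.
by apply/funext => x; rewrite indicE; case: (_ \in _); rewrite ?imK0 ?imK1.
Qed.

Local Notation L := (radon_integral mu).

Lemma radon_integralD f g :
  bounded_measurableK f -> bounded_measurableK g ->
  L (fun x => f x + g x) = L f + L g.
Proof.
move=> [fre fim] [gre gim]; rewrite /radon_integral mkKD.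
have -> : (fun x => reK (f x + g x)) = (fun x => reK (f x) + reK (g x)).
  by apply/funext => x; rewrite reKD.
have -> : (fun x => imK (f x + g x)) = (fun x => imK (f x) + imK (g x)).
  by apply/funext => x; rewrite imKD.
by rewrite !charge_integralD//; congr mkK; ring.
Qed.

Lemma radon_integralZ (c : K) f : bounded_measurableK f ->
  L (fun x => c * f x) = c * L f.
Proof.
move=> [fre fim]; rewrite /radon_integral mulK_mkK.
have re : (fun x => reK (c * f x)) =
    (fun x => reK c * reK (f x) + - imK c * imK (f x)).
  by apply/funext => x; rewrite reKM mulNr.
have im : (fun x => imK (c * f x)) =
    (fun x => reK c * imK (f x) + imK c * reK (f x)).
  by apply/funext => x; rewrite imKM.
rewrite re im !charge_integralD; do ?exact: bounded_measurableZ.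
by rewrite !charge_integralZ//; congr mkK; ring.
Qed.

Lemma radon_integral_indic E : measurable E -> L (\1_E : borel I -> K) = mu E.
Proof.
move=> mE; rewrite -[RHS]mkKE /radon_integral.
have -> : (fun x : borel I => reK (\1_E x : K)) = \1_E.
  by apply/funext => x; rewrite !indicE; case: (_ \in _); rewrite ?reK0 ?reK1.
have -> : (fun x : borel I => imK (\1_E x : K)) = (fun x => 0 * \1_E x).
  apply/funext => x; rewrite mul0r indicE.
  by case: (_ \in _); rewrite ?imK0 ?imK1.
rewrite !charge_integralZ; do ?exact: bounded_measurable_indic.
by rewrite !charge_integral_indic// !mul0r subr0 add0r.
Qed.

(** Read off from linearity of the integral on indicators, which avoids padding the pair to a
    sequence. *)
Lemma mvalU A B : measurable A -> measurable B -> A `&` B = set0 ->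
  mu (A `|` B) = mu A + mu B.
Proof.
move=> mA mB AB; rewrite -!radon_integral_indic//; last exact: measurableU.
rewrite -radon_integralD; do ?exact: bounded_measurableK_indic.
congr radon_integral; apply/funext => x; rewrite !indicE in_setU.
case: (boolP (x \in A)) => xA; case: (boolP (x \in B)) => xB;
  rewrite ?addr0 ?add0r//.
have : (A `&` B) x by split; exact: set_mem.
by rewrite AB.
Qed.

Lemma radon_integral_sum (J : Type) (s : seq J) (f : J -> borel I -> K) :
  (forall j, bounded_measurableK (f j)) ->
  bounded_measurableK (fun x => \sum_(j <- s) f j x) /\
  L (fun x => \sum_(j <- s) f j x) = \sum_(j <- s) L (f j).
Proof.
move=> bf; elim: s => [|j s [bs IH]].
  have b0 := bounded_measurableK_cst 0.
  have -> : (fun x => \sum_(j <- [::]) f j x) = cst 0.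
    by apply/funext => x; rewrite big_nil.
  (* The integral of zero vanishes by homogeneity with the scalar [0]. *)
  split=> //; rewrite big_nil; have := radon_integralZ 0 b0.
  by rewrite mul0r; under eq_fun do rewrite mul0r.
have -> : (fun x => \sum_(i <- j :: s) f i x) =
          (fun x => f j x + \sum_(i <- s) f i x).
  by apply/funext => x; rewrite big_cons.
split; first exact: bounded_measurableKD.
by rewrite radon_integralD// big_cons IH.
Qed.

(** A crude bound through the Jordan parts of the real and imaginary charges. It serves for
    continuity and for error terms; the sharp constant is that of [radon_integral_le_tv]. *)
Lemma radon_integral_bound : exists2 C : R, 0 <= C & forall f (M : R),
  bounded_measurableK f -> (forall x, rnorm (f x) <= M) -> rnorm (L f) <= C * M.
Proof.
have [C1 C10 C1P] := charge_integral_bound (re_charge mu).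
have [C2 C20 C2P] := charge_integral_bound (im_charge mu).
exists ((C1 + C2) * 2); first by rewrite mulr_ge0 ?addr_ge0.
move=> f M [fre fim] fM.
have reM x : `|reK (f x)| <= M by exact: le_trans (normr_reK_le _) _.
have imM x : `|imK (f x)| <= M by exact: le_trans (normr_imK_le _) _.
apply: le_trans (rnorm_mkK_le _ _ _) _.
rewrite mulrAC mulr_natr mulr2n mulrDl; apply: lerD.
  apply: le_trans (ler_normB _ _) _.
  by apply: lerD; [exact: C1P|exact: C2P].
apply: le_trans (ler_normD _ _) _.
by apply: lerD; [exact: C1P|exact: C2P].
Qed.

Definition tv E : R := fine (variation_measure mu E).

Lemma variation_fin E : measurable E -> variation_measure mu E \is a fin_num.
Proof.
move=> mE; rewrite ge0_fin_numE; last exact: variation_measure_ge0.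
apply: le_lt_trans (mval_tv mu).
by apply: variation_mono.
Qed.

Lemma tvE E : measurable E -> variation_measure mu E = (tv E)%:E.
Proof. by move=> mE; rewrite fineK// variation_fin. Qed.

Lemma tv_ge0 E : measurable E -> 0 <= tv E.
Proof. by move=> mE; rewrite fine_ge0// variation_measure_ge0. Qed.

(** For a step function on cells inside [E] the bound is the definition of total variation. [f] is
    within [e] of such a function; the error costs [C * e] by the crude bound, and [e] tends to
    [0]. *)
Lemma radon_integral_le_tv E f (c : R) : measurable E ->
  bounded_measurableK f -> 0 <= c -> (forall x, E x -> rnorm (f x) <= c) ->
  rnorm (L (fun x => \1_E x * f x)) <= c * tv E.
Proof.
move=> mE bf c0 fc; have [C C0 CP] := radon_integral_bound.
have bE := bounded_measurableK_indic mE.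
suff main (e : R) : 0 < e ->
    rnorm (L (fun x => \1_E x * f x)) <= (c + e) * tv E + C * e.
  apply/ler_addgt0Pr => e e0.
  (* The excess over [c * tv E] in [main] is [e * (tv E + C)]; dividing [e] by [tv E + C + 1] brings
     it below [e]. *)
  have D0 : 0 < tv E + C + 1 by rewrite ltr_wpDl// addr_ge0// tv_ge0.
  apply: le_trans (main (e / (tv E + C + 1)) (divr_gt0 e0 D0)) _.
  rewrite mulrDl -addrA lerD2l [C * _]mulrC -mulrDr mulrAC ler_pdivrMr//.
  by rewrite ler_pM2l// lerDl.
move=> e0; have e20 : 0 < e / 2 by rewrite divr_gt0.
have [N1 [q1 [c1 [mq1 q1P]]]] := bounded_measurable_quantize bf.1 e20.
have [N2 [q2 [c2 [mq2 q2P]]]] := bounded_measurable_quantize bf.2 e20.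
pose q x := (q1 x, q2 x).
pose w (j : 'I_N1 * 'I_N2) : K := mkK k (c1 j.1) (c2 j.2).
have fw x : rnorm (f x - w (q x)) <= e.
  rewrite -(mkKE (f x)) /w mkKB [e]splitr.
  by apply: le_trans (rnorm_mkK_le _ _ _) _; apply: lerD.
pose F j := E `&` q @^-1` [set j].
have mF j : measurable (F j).
  apply: measurableI => //.
  rewrite (_ : _ @^-1` _ = q1 @^-1` [set j.1] `&` q2 @^-1` [set j.2]).
    exact: measurableI.
  by apply/seteqP; split=> x; rewrite /q /=; case: j => /= a b [-> ->].
have tF : trivIset setT F by move=> i j _ _ [x [[_ <-] [_ <-]]].
have stepE : (fun x => \1_E x * w (q x)) =
             (fun x => \sum_j w j * (\1_(F j) x : K)).
  apply/funext => x; rewrite (bigD1 (q x))//= big1 ?addr0.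
    rewrite mulrC; congr (_ * _); rewrite !indicE.
    congr (_ %:R); congr nat_of_bool.
    by apply/idP/idP; rewrite !inE; [move=> ?; split|case].
  move=> j jq; rewrite indicE memNset ?mulr0// => -[_ /= qj].
  by move: jq; rewrite qj eqxx.
have bF j : bounded_measurableK (fun x => w j * (\1_(F j) x : K)).
  apply: bounded_measurableKM; first exact: bounded_measurableK_cst.
  exact: bounded_measurableK_indic.
have [bw wE] := radon_integral_sum (index_enum _) bF.
rewrite -stepE in bw wE.
have bd : bounded_measurableK (fun x => \1_E x * f x + -1 * (\1_E x * w (q x))).
  apply: bounded_measurableKD; first exact: bounded_measurableKM.
  by apply: bounded_measurableKM => //; exact: bounded_measurableK_cst.
have -> : (fun x => \1_E x * f x) = (fun x => \1_E x * w (q x) +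
    (\1_E x * f x + -1 * (\1_E x * w (q x)))).
  by apply/funext => x; rewrite mulN1r addrC subrK.
rewrite radon_integralD//; apply: le_trans (ler_rnormD _ _) _; apply: lerD.
  rewrite wE; apply: le_trans (_ : _ <= \sum_j (c + e) * rnorm (mu (F j))) _.
    elim/big_rec2: _ => [|j y z _ yz]; first by rewrite rnorm0.
    apply: le_trans (ler_rnormD _ _) _; apply: lerD => //.
    rewrite radon_integralZ; last exact: bounded_measurableK_indic.
    rewrite radon_integral_indic// rnormM.
    (* The value [w j] is controlled only through a point of its cell in [E]; an empty cell has
       measure [0] instead. *)
    have [[x [Ex /= qx]]|F0] := pselect (F j !=set0); last first.
      have -> : F j = set0 by apply/eqP/negPn/negP => /set0P.
      by rewrite mval0 rnorm0 !mulr0.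
    apply: ler_wpM2r; first exact: rnorm_ge0.
    have -> : w j = f x + (w j - f x) by rewrite addrC subrK.
    apply: le_trans (ler_rnormD _ _) _; apply: lerD; first exact: fc.
    by rewrite rnormB -qx.
  rewrite -mulr_sumr ler_wpM2l//; first by rewrite addr_ge0// ltW.
  rewrite -lee_fin -tvE// -sumEFin; apply: sum_le_variation => //.
  by move=> j; exact: subIsetl.
apply: CP => // x; rewrite mulN1r -mulrBr rnormM indicE.
case: (_ \in _); last by rewrite rnorm0 mul0r ltW.
by rewrite [X in X * _]/rnorm normr1 reK1 mul1r; exact: fw.
Qed.

(** * Total variation as a real set function, null sets and the support *)

Lemma tv_superadditive A B : measurable A -> measurable B ->
  A `&` B = set0 -> tv A + tv B <= tv (A `|` B).
Proof.
move=> mA mB AB; rewrite -lee_fin EFinD -!tvE//; last exact: measurableU.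
by apply: variation_superadditive => //; exact: variation_fin.
Qed.

Lemma tv_mono A B : measurable A -> measurable B -> A `<=` B -> tv A <= tv B.
Proof. by move=> mA mB AB; rewrite -lee_fin -!tvE//; exact: variation_mono. Qed.

Lemma rnorm_le_tv A : measurable A -> rnorm (mu A) <= tv A.
Proof.
move=> mA; rewrite -lee_fin -tvE//.
have := variation_superadditive1 mu mA measurable0 (setI0 _); rewrite setU0.
by apply: le_trans; rewrite leeDl// variation_measure_ge0.
Qed.

(** Expresses nullity through [mu] itself, so that countable unions of null sets can be handled by
    the additivity of [mu], without proving that the variation is a measure. *)
Lemma tv_eq0P A : measurable A ->
  tv A = 0 <-> forall B, measurable B -> B `<=` A -> mu B = 0.
Proof.
move=> mA; split=> [A0 B mB BA|A0].
  apply: rnorm_eq0; apply/eqP; rewrite eq_le rnorm_ge0 andbT -A0.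
  by apply: le_trans (rnorm_le_tv mB) _; exact: tv_mono.
apply/eqP; rewrite eq_le tv_ge0// andbT -lee_fin -tvE//.
apply: ge_ereal_sup => _ [F [mF tF FA] <-].
rewrite eseries0// => i _ _; rewrite A0 ?rnorm0// -FA => x Fx.
by exists i.
Qed.

(** A measurable part [B] of the union is cut into disjoint pieces, each inside a null [F i] and
    hence of measure [0]; sigma-additivity then gives [mu B = 0]. *)
Lemma tv_bigcup0 (F : (set (borel I))^nat) : (forall i, measurable (F i)) ->
  (forall i, tv (F i) = 0) -> tv (\bigcup_i F i) = 0.
Proof.
move=> mF F0; apply/tv_eq0P; first exact: bigcupT_measurable.
move=> B mB BF; pose G i := seqDU (fun n => B `&` F n) i.
have mG i : measurable (G i).
  apply: measurableD; first exact: measurableI.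
  by apply: bigsetU_measurable => j _; exact: measurableI.
have tG : trivIset setT G by exact: trivIset_seqDU.
have GB : \bigcup_i G i = B.
  rewrite -seqDU_bigcup_eq -setI_bigcupr.
  exact/setIidPl.
have := @mval_sigma _ _ _ mu _ mG tG; rewrite GB => /cvg_lim <-//.
apply/cvg_lim => //; apply: cvg_near_cst; apply: nearW => n.
rewrite big1// => i _; have /tv_eq0P := F0 i; apply => //.
by move=> x [[_ ?]].
Qed.

Lemma open_borel (U : set I) : open U -> measurable (U : set (borel I)).
Proof. by move=> oU; exact: sub_sigma_algebra. Qed.

(** An open neighbourhood violating the support condition at [x] violates it at each of its own
    points. *)
Lemma open_setC_support : open (~` radon_support mu).
Proof.
rewrite openE => x; rewrite /= /radon_support /= -existsNP => -[U].
move=> /not_implyP[oU /not_implyP[Ux U0]].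
apply: (filterS (P := U)); last exact: open_nbhs_nbhs.
move=> y Uy; rewrite /= -existsNP; exists U.
by apply/not_implyP; split=> // /(_ Uy).
Qed.

(* Inner regularity leaves only compact subsets to treat; these are covered by
   finitely many null open sets. *)
Lemma tv_setC_support : tv (~` radon_support mu) = 0.
Proof.
have mN := open_borel open_setC_support.
apply/tv_eq0P => // B mB BN; apply: rnorm_eq0; apply/eqP.
rewrite eq_le rnorm_ge0 andbT; apply/ler_addgt0Pr => e e0; rewrite add0r.
have [C [cC CB CV]] := mval_regular mu mB e0.
have mC := compact_borel cC.
have muC : mu C = 0.
  have : exists U : I -> set I, forall x, C x ->
    [/\ open (U x), U x x & tv (U x) = 0].
    suff /choice[U] : forall x, exists U : set I, C x ->
      [/\ open U, U x & tv U = 0] by exists U.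
    move=> x; have [Cx|nCx] := pselect (C x); last by exists set0.
    have := BN _ (CB _ Cx); rewrite /= /radon_support /= -existsNP => -[U].
    move=> /not_implyP[oU /not_implyP[Ux /negP U0]].
    have mU := open_borel oU; exists U => _; split=> //.
    by apply/eqP; rewrite eq_le tv_ge0// andbT -lee_fin -tvE// leNgt.
  move=> [U UP].
  have oU x : C x -> open (U x) by move=> /UP[].
  move: (cC); rewrite compact_cover => /(_ _ C U oU).
  case; first by move=> x Cx; exists x => //; have [] := UP _ Cx.
  move=> s sC CU.
  (* The finite cover becomes a sequence, padded with the null set [set0], to which [tv_bigcup0]
     applies. *)
  pose F n := nth set0 [seq U x | x <- finmap.enum_fset s] n.
  have FP n : measurable (F n : set (borel I)) /\ tv (F n) = 0.
    have [ns|ns] := ltnP n (size [seq U x | x <- finmap.enum_fset s]);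
      last first.
      rewrite /F nth_default//; split=> //; apply/tv_eq0P => // B' _.
      by rewrite subset0 => ->; rewrite mval0.
    have /mapP[x xs Fn] := mem_nth set0 ns; rewrite /F Fn.
    have /UP[? ? ?] : C x by have := sC _ xs; rewrite inE.
    by split=> //; exact: open_borel.
  have F0 := tv_bigcup0 (fun n => (FP n).1) (fun n => (FP n).2).
  move/tv_eq0P : F0; apply => //.
    by apply: bigcupT_measurable => n; exact: (FP n).1.
  move=> x /CU[y /= ys Uyx]; exists (index y (finmap.enum_fset s)) => //.
  by rewrite /F (nth_map y) ?index_mem// nth_index.
(* With [mu C = 0], only the remainder left by inner regularity counts, and its variation is below
   [e]. *)
have -> : mu B = mu (B `\` C).
  rewrite -[in LHS](setDUK CB) mvalU ?muC ?add0r//; first exact: measurableD.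
  by apply/seteqP; split=> // x [Cx []].
have mBC : measurable (B `\` C) by exact: measurableD.
by apply: le_trans (rnorm_le_tv mBC) _; rewrite -lee_fin -tvE ?ltW.
Qed.

End radon_integral_theory.

Lemma continuous_borel_measurable (R : realType) (I : pmetricType R)
    (f : I -> R) :
  continuous f -> measurable_fun setT (f : borel I -> R).
Proof.
move=> /continuousP cf; apply: (measurability _ (RGenOpens.measurableE R)).
move=> _ [_ [a [b ->] <-]]; rewrite setTI; apply: open_borel.
exact/cf/interval_open.
Qed.

(** * Strict duality bound on the support *)

Section strict_duality.
Variables (R : realType) (k : scalars) (I : pmetricType R).
Local Notation K := (scalar_field R k).
Variables (mu : radon_measure k I) (g : borel I -> K) (M : R).
Hypotheses (bg : bounded_measurableK g) (gM : forall x, rnorm (g x) <= M)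
  (mg : measurable_fun setT (fun x => rnorm (g x)))
  (g1 : forall x, radon_support mu x -> rnorm (g x) < 1)
  (mu1 : tv mu setT <= 1).

Let S : set (borel I) := radon_support mu.
(** The support need not be compact, so [rnorm (g x) < 1] on it gives no uniform gap. Each [B n] has
    the gap [1 / (n + 1)], and together they exhaust [S]. *)
Let B n : set (borel I) := S `&` [set x | rnorm (g x) <= 1 - n.+1%:R^-1].

Let mS : measurable S.
Proof.
rewrite -(setCK S); apply: measurableC.
by apply: open_borel; exact: open_setC_support.
Qed.

Let mB n : measurable (B n).
Proof.
apply: measurableI => //.
rewrite (_ : [set _ | _] = setT `&` (fun x => rnorm (g x)) @^-1`
  [set` `]-oo, 1 - n.+1%:R^-1] ]); first exact: mg.
by apply/seteqP; split=> x /=; rewrite in_itv //= => -[].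
Qed.

Let M0 : 0 <= M.
Proof. exact: le_trans (rnorm_ge0 _) (gM point). Qed.

(* Splitting [g] over [~` S], [B n] and [S `\` B n] bounds the integral of [g]
   by [1 - tv (B n) / (n + 1)]. *)
Let B_null n : 1 <= rnorm (radon_integral mu g) -> tv mu (B n) = 0.
Proof.
move=> g_ge1; have mD : measurable (S `\` B n) by exact: measurableD.
have mN := measurableC mS.
have gE : g = (fun x => \1_(~` S) x * g x +
    (\1_(B n) x * g x + \1_(S `\` B n) x * g x)).
  apply/funext => x; rewrite -!mulrDl -[LHS]mul1r; congr (_ * _).
  rewrite !indicE in_setC in_setD; case: (boolP (x \in S)) => xS /=.
    by rewrite add0r; case: (_ \in _); rewrite ?addr0 ?add0r.
  case: (boolP (x \in B n)) => xB; rewrite /= ?addr0//.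
  by move: xB; rewrite inE => -[/mem_set]; rewrite (negPf xS).
have bE E : measurable E -> bounded_measurableK (fun x => \1_E x * g x).
  move=> mE; apply: bounded_measurableKM => //.
  exact: bounded_measurableK_indic.
have n1 : (n.+1%:R^-1 : R) <= 1 by rewrite invf_le1// ler1n.
have n0 : 0 < (n.+1%:R^-1 : R) by rewrite invr_gt0.
have LN : rnorm (radon_integral mu (fun x => \1_(~` S) x * g x)) <= 0.
  rewrite -(mulr0 M) -(tv_setC_support mu).
  by apply: radon_integral_le_tv.
have LB : rnorm (radon_integral mu (fun x => \1_(B n) x * g x)) <=
    (1 - n.+1%:R^-1) * tv mu (B n).
  by apply: radon_integral_le_tv => //; [rewrite subr_ge0|move=> x []].
have LD : rnorm (radon_integral mu (fun x => \1_(S `\` B n) x * g x)) <=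
    1 * tv mu (S `\` B n).
  by apply: radon_integral_le_tv => // x [/g1/ltW].
have tvBD : tv mu (B n) + tv mu (S `\` B n) <= 1.
  apply: le_trans (tv_superadditive _ _ _ _) _ => //; first by rewrite setDIK.
  apply: le_trans mu1; apply: tv_mono => //; exact: measurableU.
have : 1 <= 1 - n.+1%:R^-1 * tv mu (B n).
  apply: le_trans g_ge1 _; rewrite gE radon_integralD; [|exact: bE|]; last first.
    by apply: bounded_measurableKD; exact: bE.
  apply: le_trans (ler_rnormD _ _) _.
  rewrite radon_integralD; [|exact: bE|exact: bE].
  have := ler_rnormD (radon_integral mu (fun x => \1_(B n) x * g x))
    (radon_integral mu (fun x => \1_(S `\` B n) x * g x)).
  by move: LB; move: (n.+1%:R^-1) => e; lra.
rewrite lerDl oppr_ge0 pmulr_rle0// => B0.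
by apply/eqP; rewrite eq_le B0 tv_ge0.
Qed.

(** Otherwise every [B n] is null, and so is the complement of [S]. These sets cover the space, so
    [mu] has total variation [0] and the integral vanishes, a contradiction. *)
Lemma rnorm_radon_integral_lt1 : rnorm (radon_integral mu g) < 1.
Proof.
rewrite ltNge; apply/negP => g_ge1.
pose F i := if i is n.+1 then B n else ~` S.
have F0 : tv mu (\bigcup_i F i) = 0.
  apply: tv_bigcup0; first by case=> //=; exact: measurableC.
  by case=> [|n] /=; [exact: tv_setC_support|exact: B_null].
have FT : \bigcup_i F i = setT.
  apply/seteqP; split=> // x _.
  have [Sx|nSx] := pselect (S x); last by exists 0%N.
  have gx : 0 < 1 - rnorm (g x) by rewrite subr_gt0 g1.
  have [N _ NP] : \forall n \near \oo, (n.+1%:R^-1 : R) < 1 - rnorm (g x).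
    exact: near_infty_natSinv_lt (PosNum gx).
  exists N.+1 => //; split=> //=.
  by have := NP N (leqnn N) => /=; rewrite ltrBrDr addrC -ltrBrDr => /ltW.
have : rnorm (radon_integral mu (fun x => \1_setT x * g x)) <= M * tv mu setT.
  by apply: radon_integral_le_tv.
rewrite -FT F0 mulr0 FT.
have -> : (fun x => \1_[set: borel I] x * g x) = g.
  by apply/funext => x; rewrite indicE mem_set ?mul1r.
by move=> /(le_trans g_ge1); rewrite ler10.
Qed.

End strict_duality.

(** * Adjoint, projection and synthesis *)

Section hilbert_operators.
Variables (R : realType) (k : scalars).
Local Notation K := (scalar_field R k).
Variables (H : completeNormedModType K) (ip : {dot H for @conjK R k}).
Hypothesis ip_norm : forall v : H, ip v v = `|v| ^+ 2.

Lemma rnorm_sum (J : finType) (F : J -> K) :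
  rnorm (\sum_j F j) <= \sum_j rnorm (F j).
Proof.
elim/big_rec2: _ => [|j y z _ yz]; first by rewrite rnorm0.
by apply: le_trans (ler_rnormD _ _) _; rewrite lerD2l.
Qed.

(** Riesz representation of the functional sending [v] to [euclidean_ip (A v) p], whose bound comes
    from the operator bound of [A] entry by entry. *)
Lemma adjointP (m : nat) (A : {linear H -> 'cV[K]_m}) : continuous A ->
  forall p v, euclidean_ip (A v) p = ip v (adjoint ip A p).
Proof.
move=> /linear_bounded_continuous/linear_boundedP/pinfty_ex_gt0[r r0 Ar] p.
suff : exists w, forall v, euclidean_ip (A v) p = ip v w by move/(xgetPex 0).
have [|a v||w wP] := riesz ip_norm (l := fun v => euclidean_ip (A v) p)
  (C := \sum_(i < m) reK r * rnorm (p i 0)).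
- move=> u v; rewrite /euclidean_ip -big_split; apply: eq_bigr => i _.
  by rewrite linearD mxE mulrDl.
- rewrite /euclidean_ip mulr_sumr; apply: eq_bigr => i _.
  by rewrite linearZ mxE mulrA.
- move=> v; rewrite /euclidean_ip; apply: le_trans (rnorm_sum _) _.
  rewrite mulr_suml; apply: ler_sum => i _; rewrite rnormM rnorm_conj mulrAC.
  rewrite ler_wpM2r ?rnorm_ge0//.
  (* The norm on columns is the maximum of the entries, hence dominates each of them. *)
  have : `|A v i 0| <= r * `|v|.
    apply: le_trans (Ar v); rewrite [leRHS]/Num.norm /= mx_normE.
    exact: (le_bigmax _ (fun ij => `|A v ij.1 ij.2|%:nng) (i, 0)).
  by move=> /reK_le; rewrite reKM imK_norm mulr0 subr0.
by exists w => v; rewrite wP.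
Qed.

(** The explicit vector has the defining property of the projection, which determines it
    uniquely. *)
Lemma orthoproj_lineC (u v : H) : `|u| = 1 ->
  orthoproj ip (orthocomplement ip (line u)) v = v - ip v u *: u.
Proof.
move=> u1; have uu : ip u u = 1 by rewrite ip_norm u1 expr1n.
set S := orthocomplement ip (line u); set w := v - _.
have wP : S w /\ orthocomplement ip S (v - w).
  split=> [_ [a _ <-]|z Sz].
    by rewrite ipZr ipBl ipZl uu mulr1 subrr mulr0.
  rewrite subKr ipZl (ipC _ u z) Sz; last by exists 1; rewrite ?scale1r.
  by apply: eqK; rewrite !(reKM, imKM, reK_conj, imK_conj, reK0, imK0); ring.
have [] : S (orthoproj ip S v) /\ orthocomplement ip S (v - orthoproj ip S v).
  apply: (xgetPex 0 (P := [set z | S z /\ orthocomplement ip S (v - z)])).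
  by exists w.
move: (orthoproj _ _ _) => z Sz zP.
(* Uniqueness: [z - w] lies in [S] and, as the difference of [v - w] and [v - z], is also orthogonal
   to [S]; it is therefore orthogonal to itself. *)
have Szw : S (z - w) by move=> x Sx; rewrite ipBl (proj1 wP)// Sz// subrr.
apply/eqP; rewrite -subr_eq0 -normr_eq0 -sqrf_eq0 -ip_norm.
have {1}-> : z - w = (v - w) - (v - z).
  by rewrite (opprB v z) [RHS]addrC addrA subrK.
by rewrite ipBl (proj2 wP)// zP// subrr.
Qed.

Section dictionary.
Variables (I : pmetricType R) (phi : I -> H).
Hypothesis phi_dict : dictionary ip phi.

Lemma dictionary_bound : exists M : R,
  forall v x, rnorm (ip (phi x) v) <= M * rnorm v.
Proof.
have [_ [M MP]] := phi_dict; exists M => v x; rewrite rnorm_ipC -lee_fin.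
by apply: le_trans (MP v); apply: ereal_sup_ubound; exists x.
Qed.

Lemma dictionary_bounded_measurable v :
  bounded_measurableK (fun x : borel I => ip (phi x) v).
Proof.
have [M MP] := dictionary_bound; have [/(_ v)[cv _] _] := phi_dict.
split; split.
- apply: continuous_borel_measurable.
  under eq_fun do rewrite ipC reK_conj; exact: continuous_reK cv.
- by exists (M * rnorm v) => x; apply: le_trans (MP v x); exact: normr_reK_le.
- apply: continuous_borel_measurable.
  under eq_fun do rewrite ipC imK_conj.
  by move=> x; apply: cvgN; exact: continuous_imK cv x.
- by exists (M * rnorm v) => x; apply: le_trans (MP v x); exact: normr_imK_le.
Qed.

(** The weak integral is conjugate-linear in the test vector, so Riesz is applied to its conjugate;
    the dictionary bound makes that functional bounded. *)
Lemma synthesisP (mu : radon_measure k I) v :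
  ip (synthesis ip phi mu) v = radon_integral mu (fun x => ip (phi x) v).
Proof.
suff : exists w, forall v, ip w v = radon_integral mu (fun x => ip (phi x) v).
  by move=> /(xgetPex 0); exact.
have bm := dictionary_bounded_measurable.
have [M MP] := dictionary_bound; have [C C0 CP] := radon_integral_bound mu.
have [||u|w wP] := riesz ip_norm (C := C * M)
  (l := fun u => conjK (radon_integral mu (fun x => ip (phi x) u))).
- move=> u w; rewrite -conjKD -radon_integralD//.
  congr (conjK (radon_integral _ _)).
  by apply/funext => x; rewrite ipDr.
- move=> a u; rewrite -[a in RHS]conjKK -conjKM -radon_integralZ//.
  by congr (conjK (radon_integral _ _)); apply/funext => x; rewrite ipZr.
- by rewrite rnorm_conj -mulrA; apply: CP => // x; exact: MP.
by exists w => u; rewrite ipC wP conjKK.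
Qed.

End dictionary.

End hilbert_operators.

(** * Coherence of the support of a minimizer with [phi x0] *)

Theorem theorem3p2 (R : realType) (k : scalars)
    (H : completeNormedModType (scalar_field R k))
    (ip : {dot H for @conjK R k})
    (ip_norm : forall v : H, ip v v = `|v| ^+ 2)
    (I : pmetricType R)
    (I_locally_compact : locally_compact [set: I])
    (I_separable : separable_space I)
    (phi : I -> H)
    (phi_dictionary : dictionary ip phi)
    (phi_normalized : forall x : I, `|phi x| = 1)
    (r : nat) (Phi : 'I_r -> set H)
    (phi_union : range phi = \bigcup_(j in [set: 'I_r]) Phi j)
    (m : nat) (A : {linear H -> 'cV[scalar_field R k]_m})
    (A_continuous : continuous A)
    (v0 : H) (x0 : I) (c0 : scalar_field R k) (muc : radon_measure k I)
    (v0E : v0 = synthesis ip phi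
                  (radon_add (radon_scale c0 (radon_dirac k x0)) muc))
    (v0_atomic : atomic_norm ip phi v0 =
                 tv_norm (radon_add (radon_scale c0 (radon_dirac k x0)) muc))
    (mu0_tv : tv_norm (radon_add (radon_scale c0 (radon_dirac k x0)) muc) = 1%E)
    (j0 : 'I_r) (phi_x0_j0 : Phi j0 (phi x0))
    (sigma t : R) (sigma_ge0 : 0 <= sigma) (t_gt0 : 0 < t) (t_le1 : t <= 1)
    (nu_exists : exists nu : H,
       [/\ range (adjoint ip A) nu,
           1 <= reK (radon_integral
                  (radon_add (radon_scale c0 (radon_dirac k x0)) muc)
                  (fun x => ip (phi x) nu)),
           forall j : 'I_r, j != j0 -> (dual_atomic_norm ip (Phi j) nu < 1)%E,
           rnorm (ip nu (phi x0)) <= sigma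
         & (dual_atomic_norm ip (Phi j0)
              (orthoproj ip (orthocomplement ip (line (phi x0))) nu)
            <= (1 - t)%:E)%E])
    (mu_star : radon_measure k I)
    (mu_star_min : tv_minimizer ip A phi (A v0) mu_star) :
  exists x : I, [/\ radon_support mu_star x,
                    Phi j0 (phi x)
                  & (t%:E / sigma%:E <= (rnorm (ip (phi x) (phi x0)))%:E)%E].
Proof.
have [nu [[p _ nuE] nu_ge1 nu_j nu_x0 nu_j0]] := nu_exists.
set mu0 := radon_add _ _ in v0E mu0_tv nu_ge1 v0_atomic.
have [mu_feasible mu_min] := mu_star_min.
apply: contrapT => no_x.
pose g (x : borel I) := ip (phi x) nu.
have mu_ge1 : 1 <= rnorm (radon_integral mu_star g).
  (* With [nu] the adjoint applied to [p], the integral of [g] against [mu] is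
     [euclidean_ip (A (synthesis ip phi mu)) p], which depends only on the measurements. *)
  have -> : radon_integral mu_star g = radon_integral mu0 g.
    rewrite -!(synthesisP ip_norm phi_dictionary) -nuE.
    by rewrite -!(adjointP ip_norm A_continuous) mu_feasible v0E.
  exact: le_trans nu_ge1 (le_trans (ler_norm _) (normr_reK_le _)).
have [M MP] := dictionary_bound phi_dictionary.
suff : rnorm (radon_integral mu_star g) < 1 by rewrite ltNge mu_ge1.
apply: (rnorm_radon_integral_lt1 (M := M * rnorm nu)).
- exact: dictionary_bounded_measurable.
- exact: MP.
- apply: continuous_borel_measurable; have [/(_ nu)[cnu _] _] := phi_dictionary.
  by under eq_fun do rewrite rnorm_ipC; exact: continuous_rnorm cnu.
- move=> x xmu; rewrite /g rnorm_ipC.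
  have : range phi (phi x) by exists x.
  rewrite phi_union => -[j _ jx]; have [jj0|jj0] := eqVneq j j0; last first.
    rewrite -lte_fin; apply: le_lt_trans (nu_j _ jj0).
    by apply: ereal_sup_ubound; exists (phi x).
  rewrite {}jj0 in jx.
  (* The product form covers [sigma = 0], where the left side vanishes. If it failed, [sigma] would
     be positive and division would give the bound that [no_x] excludes. *)
  have coherence : rnorm (ip (phi x) (phi x0)) * sigma < t.
    rewrite ltNge; apply/negP => tx; apply: no_x; exists x; split => //.
    have sigma0 : 0 < sigma.
      rewrite lt_neqAle sigma_ge0 andbT; apply/eqP => s0.
      by move: tx; rewrite -s0 mulr0 leNgt t_gt0.
    by rewrite inver gt_eqF// -EFinM lee_fin ler_pdivrMr.
  set P := orthoproj _ _ nu in nu_j0.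
  have nuP : nu = P + ip nu (phi x0) *: phi x0.
    by rewrite /P orthoproj_lineC ?phi_normalized// subrK.
  have Px : rnorm (ip P (phi x)) <= 1 - t.
    rewrite -lee_fin; apply: le_trans nu_j0.
    by apply: ereal_sup_ubound; exists (phi x).
  rewrite nuP ipDl ipZl; apply: le_lt_trans (ler_rnormD _ _) _.
  rewrite rnormM (rnorm_ipC _ (phi x0)).
  have : rnorm (ip nu (phi x0)) * rnorm (ip (phi x) (phi x0)) <=
      rnorm (ip (phi x) (phi x0)) * sigma.
    by rewrite mulrC ler_wpM2l// rnorm_ge0.
  lra.
(* [mu0] synthesizes [v0], so it is feasible and its total variation [1] bounds that of the
   minimizer. *)
- rewrite -lee_fin -tvE// -mu0_tv; apply: mu_min.
  by rewrite v0E.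
Qed.
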